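(* Let $R$ be a semiprime ring satisfying ACC on left annihilators. Suppose that every left ideal $0\neq I\subseteq R$ contains a uniform left ideal of $R$. Then there is a bijective correspondence between the set of representatives of isomorphism classes of indecomposable nonsingular injective $R$-modules and the set of minimal prime ideals of $R$.
   Context: $R$ is an associative ring with unity and $R$-modules are unitary left $R$-modules; singularity is that of left modules. A left ideal is uniform if it is nonzero and any two nonzero left ideals contained in it have nonzero intersection. The set of representatives is a complete set: one representative for each isomorphism class. *)

(* Defs.v *)
From HB Require Import structures.
From mathcomp Require Import all_boot all_order all_algebra.
From mathcomp Require Import boolp classical_sets.

Set Implicit Arguments.
Unset Strict Implicit.
Unset Printing Implicit Defensive.

Import GRing.Theory.

Local Open Scope classical_set_scope.
Local Open Scope ring_scope.

(* Rings are [pzRingType]s: associative, unital, possibly zero.  Modules are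
   [lmodType]s: unitary left modules.  The left ideals of [R] are the submodules
   of the regular module [R^o], where [a *: x] is [a * x]. *)

Section Modules.
Variable R : pzRingType.
Implicit Types (V W : lmodType R).

Definition submodule V (A : set V) : Prop := submod_closed [in A].

Definition isomorphic V W : Prop := exists f : {linear V -> W}, bijective f.

Definition injective_module V : Prop :=
  forall (A B : lmodType R) (i : {linear A -> B}) (g : {linear A -> V}),
    injective i -> exists h : {linear B -> V}, forall a, h (i a) = g a.

Definition indecomposable V : Prop :=
  (exists x : V, x <> 0) /\
  forall A B : set V, submodule A -> submodule B ->
    A `&` B = [set 0] -> [set a + b | a in A & b in B] = [set: V] ->
    A = [set 0] \/ B = [set 0].

End Modules.

Section Ideals.
Variable R : pzRingType.
Implicit Types (I J P : set R).

Definition left_ideal I : Prop := @submodule R R^o I.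

Definition ideal I : Prop := left_ideal I /\ forall x a, I x -> I (x * a).

Definition uniform_left_ideal U : Prop :=
  [/\ left_ideal U, U <> [set 0] &
    forall I J, left_ideal I -> left_ideal J -> I `<=` U -> J `<=` U ->
      I <> [set 0] -> J <> [set 0] -> I `&` J <> [set 0]].

Definition essential_left_ideal E : Prop :=
  left_ideal E /\
  forall I, left_ideal I -> I <> [set 0] -> E `&` I <> [set 0].

(* An ideal contains the product ideal [I J] iff it contains all the products
   [x * y] with [x] in [I] and [y] in [J], as these generate [I J]. *)
Definition prime_ideal P : Prop :=
  [/\ ideal P, P <> [set: R] &
    forall I J, ideal I -> ideal J ->
      (forall x y, I x -> J y -> P (x * y)) -> I `<=` P \/ J `<=` P].

Definition minimal_prime_ideal P : Prop :=
  prime_ideal P /\ forall Q, prime_ideal Q -> Q `<=` P -> Q = P.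

Definition semiprime_ideal P : Prop :=
  ideal P /\
  forall I, ideal I -> (forall x y, I x -> I y -> P (x * y)) -> I `<=` P.

Definition left_annihilator (X : set R) : set R :=
  [set r | forall x, X x -> r * x = 0].

End Ideals.

Definition semiprime_ring (R : pzRingType) : Prop :=
  @semiprime_ideal R [set 0].

Definition acc_left_annihilators (R : pzRingType) : Prop :=
  forall A : nat -> set R,
    (forall n, exists X, A n = left_annihilator X) ->
    (forall n, A n `<=` A n.+1) ->
    exists n, forall m, (n <= m)%N -> A m = A n.

Definition singular_submodule (R : pzRingType) (V : lmodType R) : set V :=
  [set x | essential_left_ideal [set r : R | r *: x = 0]].
Arguments singular_submodule {R} V _.

Definition nonsingular (R : pzRingType) (V : lmodType R) : Prop :=
  singular_submodule V = [set 0].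

Definition indecomposable_nonsingular_injective
    (R : pzRingType) (V : lmodType R) : Prop :=
  [/\ indecomposable V, nonsingular V & injective_module V].

(* The family [E] lists exactly one module from each isomorphism class of
   modules satisfying [C]. *)
Definition representatives (R : pzRingType) (C : lmodType R -> Prop)
    (T : Type) (E : T -> lmodType R) : Prop :=
  [/\ forall t, C (E t),
      forall V, C V -> exists t, isomorphic V (E t) &
      forall s t, isomorphic (E s) (E t) -> s = t].

(* Main.v *)
Require Import Defs.
From HB Require Import structures.
From mathcomp Require Import all_boot all_order all_algebra.
From mathcomp Require Import boolp classical_sets functions.

Set Implicit Arguments.
Unset Strict Implicit.
Unset Printing Implicit Defensive.

Import GRing.Theory.

Local Open Scope classical_set_scope.
Local Open Scope ring_scope.

(** The correspondence sends a module [V] to its assassinator, the set of the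
    [p] that annihilate some nonzero submodule of [V].

    On the ring side, ACC on left annihilators and semiprimeness make [R] left
    nonsingular ([acc_nonsingular]).  If [U] is a uniform left ideal then its
    left annihilator is a minimal prime ideal, and ACC shows that every minimal
    prime arises in this way ([annihilator_uniform_minimal],
    [minimal_prime_annihilator]).

    On the module side, let [V] be indecomposable, nonsingular and injective.
    Then [V] is uniform ([indecomposable_uniform]).  The annihilator of a
    nonzero [x] in [V] is not essential, so it meets some nonzero left ideal
    trivially; a uniform left ideal [U] inside the latter embeds in [V] by
    [u |-> u x] ([nonsingular_embeds]), and the assassinator of [V] is the left
    annihilator of [U] ([assassin_uniform]), a minimal prime.

    Two such modules [V] and [W] with the same assassinator contain uniform left
    ideals [U] and [U'] with the same annihilator.  Then [U U'] is nonzero, as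
    otherwise [U] would annihilate itself; so some right multiplication maps [U]
    to [U'] nontrivially, hence injectively.  Thus [V] and [W] share a nonzero
    submodule, and injectivity and indecomposability extend this to an
    isomorphism ([assassin_complete]).

    Surjectivity needs, for a uniform left ideal [U], an injective hull of [U].
    For a nonsingular module [M] the hull is the direct limit of the groups
    [Hom(L, M)] over the essential left ideals [L]: homomorphisms defined on an
    essential left ideal, up to agreement on a smaller one ([hull]).  Its
    injectivity follows from Baer's criterion, since a homomorphism from a left
    ideal to the hull is determined by its restriction to the elements sent into
    [M], and that restriction extends to an essential left ideal. *)

(** * Submodules, complements and essential submodules *)

Section Submodules.
Variable R : pzRingType.
Implicit Types V W : lmodType R.

Lemma submoduleP V (A : set V) :
  submodule A <->
  A 0 /\ (forall a u v, A u -> A v -> A (a *: u + v)).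
Proof.
rewrite /submodule /GRing.submod_closed; split=> -[A0 Alin].
  split; first by move: A0; rewrite inE.
  by move=> a u v Au Av; apply/set_mem/Alin; rewrite inE.
split; first by rewrite inE.
by move=> a u v; rewrite !inE; apply: Alin.
Qed.

Lemma submod0 V (A : set V) : submodule A -> A 0.
Proof. by case/submoduleP. Qed.

Lemma submodD V (A : set V) u v : submodule A -> A u -> A v -> A (u + v).
Proof. by case/submoduleP=> _ + Au Av => /(_ 1 u v Au Av); rewrite scale1r. Qed.

Lemma submodZ V (A : set V) a u : submodule A -> A u -> A (a *: u).
Proof. by case/submoduleP=> A0 + Au => /(_ a u 0 Au A0); rewrite addr0. Qed.

Lemma submodN V (A : set V) u : submodule A -> A u -> A (- u).
Proof. by move=> sA Au; rewrite -scaleN1r; apply: submodZ. Qed.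

Lemma submodB V (A : set V) u v : submodule A -> A u -> A v -> A (u - v).
Proof. by move=> sA Au Av; apply: submodD => //; apply: submodN. Qed.

Lemma submodI V (A B : set V) :
  submodule A -> submodule B -> submodule (A `&` B).
Proof.
move=> sA sB; apply/submoduleP; split; first by split; apply: submod0.
by move=> a u v [Au Bu] [Av Bv]; split; apply: submodD => //; apply: submodZ.
Qed.

Lemma submod_sum V (A B : set V) :
  submodule A -> submodule B -> submodule [set a + b | a in A & b in B].
Proof.
move=> sA sB; apply/submoduleP; split.
  by exists 0; [apply: submod0|exists 0; [apply: submod0|rewrite addr0]].
move=> a _ _ [u Au [v Bv <-]] [u' Au' [v' Bv' <-]].
exists (a *: u + u'); first by apply: submodD => //; apply: submodZ.
exists (a *: v + v'); first by apply: submodD => //; apply: submodZ.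
by rewrite scalerDr addrACA.
Qed.

Lemma submod_neq0 V (A : set V) :
  submodule A -> A <> [set 0] <-> exists2 x, A x & x <> 0.
Proof.
move=> sA; split=> [nA|[x Ax x0] A0]; last by apply: x0; move: Ax; rewrite A0.
apply: contrapT => noA; apply: nA; rewrite eqEsubset; split=> x.
  by move=> Ax; apply: contrapT => x0; apply: noA; exists x.
by move=> ->; apply: submod0.
Qed.

Lemma submod_line V (x : V) : submodule [set r *: x | r in [set: R]].
Proof.
apply/submoduleP; split; first by exists 0; rewrite ?scale0r.
move=> a _ _ [r _ <-] [s _ <-]; exists (a * r + s) => //.
by rewrite scalerDl scalerA.
Qed.

Definition adjoin V (A : set V) (v : V) : set V :=
  [set x | exists c r, A c /\ x = c + r *: v].

Lemma submod_adjoin V (A : set V) v : submodule A -> submodule (adjoin A v).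
Proof.
move=> sA; apply/submoduleP; split.
  by exists 0, 0; split; [apply: submod0|rewrite scale0r addr0].
move=> a _ _ [c [r [Ac ->]]] [d [s [Ad ->]]].
exists (a *: c + d), (a * r + s); split.
  by apply: submodD => //; apply: submodZ.
by rewrite scalerDr scalerDl scalerA addrACA.
Qed.

Lemma sub_adjoin V (A : set V) v : A `<=` adjoin A v.
Proof. by move=> x Ax; exists x, 0; rewrite scale0r addr0. Qed.

Lemma mem_adjoin V (A : set V) v : submodule A -> adjoin A v v.
Proof.
by move=> sA; exists 0, 1; rewrite scale1r add0r; split=> //; apply: submod0.
Qed.

(** A relative complement by Zorn's lemma.  Maximality is stated elementwise:
    it says that the only [v] for which adjoining [v] keeps the meet with [B]
    trivial are those already in [C].  Applied to [B = 0 x V] in a product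
    [W x V], it also yields maximal partial homomorphisms from [W] to [V], since
    a submodule of [W x V] is the graph of one iff it meets [0 x V]
    trivially. *)
Lemma complement_exists V (A B : set V) :
  submodule A -> (forall x, A x -> B x -> x = 0) ->
  exists C, [/\ submodule C, A `<=` C, forall x, C x -> B x -> x = 0 &
    forall v, (forall c r, C c -> B (c + r *: v) -> c + r *: v = 0) -> C v].
Proof.
move=> sA AB0.
(* The union with [A] makes [Q] hold for the union of an empty chain. *)
pose Q X := submodule (A `|` X) /\ (forall x, (A `|` X) x -> B x -> x = 0).
have [F FQ Ftot|X [[sX XB0] Xmax]] := @Zorn_bigcup V Q.
  have cover u v : (A `|` \bigcup_(X in F) X) u ->
      (A `|` \bigcup_(X in F) X) v ->
      exists X, [/\ Q X, X `<=` \bigcup_(X in F) X, (A `|` X) u & (A `|` X) v].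
    have Q0 : Q set0 by split; rewrite setU0.
    move=> [Au|[X FX Xu]] [Av|[Y FY Yv]].
    - by exists set0; split=> //; left.
    - by exists Y; split; [apply: FQ|apply: bigcup_sup|left|right].
    - by exists X; split; [apply: FQ|apply: bigcup_sup|right|left].
    - have [XY|YX] := Ftot _ _ FX FY.
        exists Y; split; [exact: FQ|exact: bigcup_sup| |by right].
        by right; apply: XY.
      exists X; split; [exact: FQ|exact: bigcup_sup|by right|].
      by right; apply: YX.
  split; last first.
    by move=> x Fx Bx; have [X [[_ +] _ Xx _]] := cover _ _ Fx Fx; apply.
  apply/submoduleP; split; first by left; apply: submod0.
  move=> a u v Fu Fv; have [X [[sX _] XF Xu Xv]] := cover _ _ Fu Fv.
  have : (A `|` X) (a *: u + v) by apply: submodD => //; apply: submodZ.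
  by case=> [?|/XF ?]; [left|right].
exists (A `|` X); split=> //.
move=> v vB; apply: contrapT => nv.
apply: (Xmax (adjoin (A `|` X) v)).
  split; last by move=> /(_ v (mem_adjoin _ sX)) Xv; apply: nv; right.
  by move=> x Xx; apply: sub_adjoin; right.
rewrite /Q; have -> : A `|` adjoin (A `|` X) v = adjoin (A `|` X) v.
  by apply: setUidr => x Ax; apply: sub_adjoin; left.
by split; [apply: submod_adjoin|move=> _ [c [r [Xc ->]]]; apply: vB].
Qed.

(** Every nonzero vector has a nonzero multiple in [A]: equivalent to [A] having
    nonzero meet with every nonzero submodule, and easier to use. *)
Definition essential V (A : set V) :=
  submodule A /\ forall v, v <> 0 -> exists2 r, A (r *: v) & r *: v <> 0.

(** If no nonzero multiple of [v] were in [C + B], adjoining [v] to [C] would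
    keep the meet with [B] trivial, so that maximality would put [v] in [C]. *)
Lemma essential_sum V (C B : set V) :
  submodule C -> submodule B ->
  (forall x, C x -> B x -> x = 0) ->
  (forall v, (forall c r, C c -> B (c + r *: v) -> c + r *: v = 0) -> C v) ->
  essential [set c + b | c in C & b in B].
Proof.
move=> sC sB CB0 Cmax; split; first exact: submod_sum.
move=> v v0; apply: contrapT => noS.
have triv r c b : C c -> B b -> c + b = r *: v -> r *: v = 0.
  move=> Cc Bb E; apply: contrapT => rv0; apply: noS; exists r => //.
  by exists c => //; exists b.
have Cv : C v.
  apply: Cmax => c r Cc Bc.
  have rv0 : r *: v = 0.
    by apply: (triv r _ _ (submodN sC Cc) Bc); rewrite addKr.
  by move: Bc; rewrite rv0 addr0; apply: CB0.
apply: v0; rewrite -[v]scale1r.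
by apply: (triv 1 v 0); rewrite ?addr0 ?scale1r //; apply: submod0.
Qed.

Lemma essential_left_idealP (E : set R) :
  essential_left_ideal E <-> @essential R^o E.
Proof.
split=> -[sE Eess]; split=> //.
  move=> v v0; pose I : set R^o := [set r *: v | r in [set: R]].
  have sI : submodule I := submod_line (v : R^o).
  have I0 : I <> [set 0].
    by apply/submod_neq0 => //; exists v => //; exists 1; rewrite ?scale1r.
  have sEI := submodI sE sI.
  have /(submod_neq0 sEI)[x [Ex [r _ rvx]] x0] := Eess I sI I0.
  by exists r; rewrite /= rvx.
move=> I sI /(submod_neq0 sI)[x Ix x0].
apply/(submod_neq0 (submodI sE sI)).
have [r Er rx] := Eess x x0; exists (r * x) => //; split=> //.
exact: (@submodZ R^o).
Qed.

Lemma essentialT V : essential [set: V].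
Proof.
by split=> [|v v0]; [apply/submoduleP|exists 1; rewrite ?scale1r].
Qed.

Lemma essentialI V (A B : set V) :
  essential A -> essential B -> essential (A `&` B).
Proof.
move=> [sA eA] [sB eB]; split; first exact: submodI.
move=> v /eA[r Ar /eB[s Bs s0]]; exists (s * r); rewrite -scalerA //.
by split=> //; apply: submodZ.
Qed.

Lemma essentialS V (A B : set V) :
  submodule B -> A `<=` B -> essential A -> essential B.
Proof.
move=> sB AB [_ eA]; split=> // v /eA[r Ar r0]; exists r => //; exact: AB.
Qed.

Lemma submod_colon V (A : set V) v :
  submodule A -> @submodule R R^o [set r | A (r *: v)].
Proof.
move=> sA; apply/submoduleP; split; first by rewrite /= scale0r; apply: submod0.
move=> a r s /= Ar As; rewrite scalerDl -scalerA.
by apply: submodD => //; apply: submodZ.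
Qed.

Lemma essential_colon V (A : set V) v :
  essential A -> @essential R^o [set r | A (r *: v)].
Proof.
move=> [sA eA]; split; first exact: submod_colon.
move=> r r0; have [rv|/eA[s As s0]] := pselect (r *: v = 0).
  by exists 1; rewrite /= scale1r // rv; apply: submod0.
exists s; rewrite /= -?scalerA // => sr0.
by apply: s0; rewrite scalerA (sr0 : s * r = 0) scale0r.
Qed.

(** In this form, an equation in a nonsingular module may be checked after
    multiplication by the elements of an essential left ideal. *)
Lemma nonsingularP V :
  nonsingular V <->
  forall (x : V) (L : set R), @essential R^o L ->
    (forall r, L r -> r *: x = 0) -> x = 0.
Proof.
rewrite /nonsingular; split=> [ns x L eL Lx|ns].
  suff : singular_submodule V x by rewrite ns.
  apply/essential_left_idealP; apply: essentialS eL => //.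
  apply: (@submod_colon V [set 0]); apply/submoduleP; split=> // a u v -> ->.
  by rewrite scaler0 addr0.
rewrite eqEsubset; split=> x; first by move=> /essential_left_idealP/ns; apply.
move=> ->; apply/essential_left_idealP.
have := essentialT R^o; congr (essential _).
by apply/seteqP; split=> // r _; rewrite /= scaler0.
Qed.

End Submodules.

Definition submod_pred (R : pzRingType) (V : lmodType R) (A : set V)
  & submodule A : {pred V} := [in A].

HB.instance Definition _ (R : pzRingType) (V : lmodType R) (A : set V)
    (sA : submodule A) :=
  GRing.isSubmodClosed.Build R V (submod_pred sA) (GRing.submod_closed_semi sA).

Definition submod_type (R : pzRingType) (V : lmodType R) (A : set V)
  (sA : submodule A) := {x : V | x \in submod_pred sA}.

Section SubmoduleType.
Variables (R : pzRingType) (V : lmodType R) (A : set V) (sA : submodule A).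

HB.instance Definition _ := SubChoice.on (submod_type sA).
HB.instance Definition _ := [SubChoice_isSubLmodule of submod_type sA by <:].

Lemma submod_typeP (x : submod_type sA) : A (val x).
Proof. exact: set_mem (valP x). Qed.

Lemma submod_type_sub x : A x -> exists y : submod_type sA, val y = x.
Proof. by move=> Ax; exists (Sub x (mem_set Ax)); rewrite SubK. Qed.

End SubmoduleType.

(** * Injective modules *)

Section Injective.
Variable R : pzRingType.
Implicit Types V W : lmodType R.

Lemma linear_mapP V W (f : V -> W) :
  linear f -> exists g : {linear V -> W}, g =1 f.
Proof.
move=> lf; pose m := GRing.isLinear.Build _ _ _ _ f lf.
by exists (HB.pack_for {linear V -> W} f m).
Qed.

(** The form in which injectivity is used: a partial homomorphism from [W] to
    [V], given by its graph [G], extends to [W].  The graph itself serves as the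
    domain module, with the two projections as maps. *)
Lemma injective_extend V W (G : set (W * V)) :
  injective_module V -> submodule G -> (forall v, G (0, v) -> v = 0) ->
  exists h : {linear W -> V}, forall w v, G (w, v) -> h w = v.
Proof.
move=> injV sG G0.
have [i iE] : exists i : {linear submod_type sG -> W},
    i =1 (fun p => (val p).1).
  by apply: linear_mapP => a p q; rewrite linearP.
have [g gE] : exists g : {linear submod_type sG -> V},
    g =1 (fun p => (val p).2).
  by apply: linear_mapP => a p q; rewrite linearP.
have [|h hE] := injV _ _ i g.
  move=> p q; rewrite !iE => pq; apply/eqP; rewrite -subr_eq0; apply/eqP.
  apply: val_inj; rewrite linear0.
  have fst0 : (val (p - q)).1 = 0 by rewrite linearB /= pq subrr.
  have := submod_typeP (p - q); case: (val _) fst0 => w v /= -> /G0 ->.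
  by [].
exists h => w v Gwv; have [p pE] := submod_type_sub sG Gwv.
by have := hE p; rewrite iE gE pE.
Qed.

(** A maximal partial homomorphism extending the given one is total: for [b]
    outside its domain, the partial homomorphism [r |-> G (r b)] on a left ideal
    is multiplication by some [x], and [b |-> x] is a compatible extension. *)
Lemma baer_criterion V :
  (forall G : set (R^o * V), submodule G -> (forall v, G (0, v) -> v = 0) ->
     exists x : V, forall (r : R) v, G (r, v) -> v = r *: x) ->
  injective_module V.
Proof.
move=> baerV A B i g inj_i.
pose G0 : set (B * V) := [set p | exists a, p = (i a, g a)].
have sG0 : submodule G0.
  apply/submoduleP; split; first by exists 0; rewrite !linear0.
  by move=> c _ _ [a ->] [b ->]; exists (c *: a + b); rewrite !linearP.
have [|G [sG G0G Gfun Gmax]] :=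
  @complement_exists R _ G0 [set p | p.1 = 0] sG0.
  move=> _ [a ->] /= ia; have -> : a = 0 by apply: inj_i; rewrite ia linear0.
  by rewrite !linear0.
have {}Gfun v : G (0, v) -> v = 0 by move=> /Gfun /(_ erefl) [].
have Gfunc b v w : G (b, v) -> G (b, w) -> v = w.
  move=> Gv Gw; apply/eqP; rewrite -subr_eq0; apply/eqP; apply: Gfun.
  by have := submodB sG Gv Gw; rewrite [_ - _]surjective_pairing /= subrr.
have Gtot b : exists v, G (b, v).
  pose Gb : set (R^o * V) := [set p | G ((p.1 : R) *: b, p.2)].
  have sGb : submodule Gb.
    apply/submoduleP; split.
      by rewrite /Gb /= scale0r; apply: (submod0 sG).
    move=> c [r v] [s w]; rewrite /Gb /= => Gr Gs.
    rewrite scalerDl -scalerA.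
    exact: (submodD sG (submodZ c sG Gr) Gs).
  have [|x xE] := baerV Gb sGb.
    by move=> v; rewrite /Gb /= scale0r; apply: Gfun.
  exists x; apply: Gmax => -[c v] r Gc /= cr.
  suff vE : v = (- r) *: x.
    by rewrite [LHS]surjective_pairing /= cr vE scaleNr addNr.
  apply: xE; rewrite /Gb /= scaleNr; suff <- : c = - (r *: b) by [].
  by apply/eqP; rewrite -addr_eq0 cr.
have [h hE] := choice Gtot.
have [f fE] : exists f : {linear B -> V}, f =1 h.
  apply: linear_mapP => c x y; apply: (Gfunc _ _ _ (hE _)).
  exact: (submodD sG (submodZ c sG (hE x)) (hE y)).
exists f => a; rewrite fE; apply: (Gfunc (i a)) (hE _) _.
by apply: G0G; exists a.
Qed.

Definition uniform V := forall x y : V, x <> 0 -> y <> 0 ->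
  exists r s, r *: x = s *: y /\ r *: x <> 0.

Lemma submod_ker V W (f : {linear V -> W}) : submodule [set x | f x = 0].
Proof.
apply/submoduleP; split; first exact: linear0.
by move=> a u v /= fu fv; rewrite linearP fu fv scaler0 addr0.
Qed.

(** The target splits as the image of [h] plus the kernel of [k]; the image is
    nonzero, so the kernel vanishes. *)
Lemma split_mono_bijective V W (h : {linear V -> W}) (k : {linear W -> V}) :
  indecomposable W -> cancel h k -> (exists x : V, x <> 0) -> bijective h.
Proof.
move=> [_ indW] hK [x x0].
pose A := [set h v | v in [set: V]].
have sA : submodule A.
  apply/submoduleP; split; first by exists 0; rewrite ?linear0.
  by move=> a _ _ [u _ <-] [v _ <-]; exists (a *: u + v); rewrite // linearP.
have [||A0|K0] := indW A [set w | k w = 0] sA (submod_ker k).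
- rewrite eqEsubset; split=> [_ [[v _ <-] /= ]|_ ->].
    by rewrite hK => ->; rewrite linear0.
  by split; [apply: submod0|rewrite /= linear0].
- rewrite eqEsubset; split=> // w _; exists (h (k w)); first by exists (k w).
  by exists (w - h (k w)); rewrite /= ?linearB /= ?hK ?subrr // addrC subrK.
- have : A (h x) by exists x.
  by rewrite A0 /= => hx; case: x0; rewrite -[x]hK hx linear0.
exists k => // w; apply/eqP; rewrite -subr_eq0; apply/eqP.
have : [set w | k w = 0] (h (k w) - w) by rewrite /= linearB /= hK subrr.
by rewrite K0.
Qed.

(** Given [x] and [y] with no common nonzero multiple, take [A] containing [x]
    and maximal among the submodules meeting [B = R y] trivially.  The
    projection of the essential submodule [A + B] onto [A] extends to [h] on
    [V].  By nonsingularity the image of [h] still meets [B] trivially, so it is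
    contained in [A] by maximality, and [V] is the direct sum of [A] and the
    kernel of [h], both nonzero. *)
Lemma indecomposable_uniform V : nonsingular V -> injective_module V ->
  indecomposable V -> uniform V.
Proof.
move=> /nonsingularP nsV injV [_ indV] x y x0 y0; apply: contrapT => nu.
pose B := [set s *: y | s in [set: R]]; have sB : submodule B := submod_line y.
have [|A [sA xA AB0 Amax]] := complement_exists (B := B) (submod_line x).
  move=> _ [r _ <-] [s _ sr]; apply: contrapT => rx; apply: nu.
  by exists r, s; rewrite sr.
have eAB := essential_sum sA sB AB0 Amax.
pose G : set (V * V) := [set p | exists a b, [/\ A a, B b & p = (a + b, a)]].
have sG : submodule G.
  apply/submoduleP; split.
    by exists 0, 0; split; rewrite ?addr0 //; apply: submod0.
  move=> c _ _ [a [b [Aa Bb ->]]] [a' [b' [Aa' Bb' ->]]].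
  exists (c *: a + a'), (c *: b + b'); split.
  - by apply: submodD => //; apply: submodZ.
  - by apply: submodD => //; apply: submodZ.
  - by rewrite addrACA -scalerDr.
have [|h hE] := injective_extend injV sG.
  move=> _ [a [b [Aa Bb [ab ->]]]]; apply: AB0 => //.
  by have -> : a = - b; [apply/eqP; rewrite -addr_eq0 -ab|apply: submodN].
have hA a : A a -> h a = a.
  move=> Aa; apply: hE; exists a, 0; split; rewrite ?addr0 //; exact: submod0.
have hB b : B b -> h b = 0.
  move=> Bb; apply: hE; exists 0, b; split; rewrite ?add0r //; exact: submod0.
(* As [c + r h v] is [h (c + r v)], an essential left ideal sends it into
   [h (A + B) = A]; when it lies in [B], that left ideal kills it. *)
have hV v : A (h v).
  apply: Amax => c r Ac Bcr.
  apply: (nsV _ _ (essential_colon (c + r *: v) eAB)).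
  move=> s [a Aa [b Bb abE]]; apply: AB0.
    have -> : s *: (c + r *: h v) = h (s *: (c + r *: v)).
      by rewrite linearZ linearD linearZ /= (hA c).
    by rewrite -abE linearD /= hA // hB // addr0.
  exact: submodZ.
have [||A0|K0] := indV A [set v | h v = 0] sA (submod_ker h).
- rewrite eqEsubset; split=> [a [Aa]|_ ->] /=; first by rewrite hA.
  by split; [apply: submod0|rewrite linear0].
- rewrite eqEsubset; split=> // v _; exists (h v) => //; exists (v - h v).
    by rewrite /= linearB /= (hA (h v)) // subrr.
  by rewrite addrC subrK.
- have : A x by apply: xA; exists 1; rewrite ?scale1r.
  by rewrite A0 => /x0.
apply: y0; have : [set v | h v = 0] y by apply: hB; exists 1; rewrite ?scale1r.
by rewrite K0.
Qed.

Lemma uniform_indecomposable V :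
  uniform V -> (exists x : V, x <> 0) -> indecomposable V.
Proof.
move=> uV nzV; split=> // A B sA sB AB _; apply: contrapT.
move=> /not_orP[/(submod_neq0 sA)[x Ax x0] /(submod_neq0 sB)[y By y0]].
have [r [s [rs r0]]] := uV x y x0 y0.
have : (A `&` B) (r *: x) by split; [|rewrite rs]; apply: submodZ.
by rewrite AB => /r0.
Qed.

End Injective.

Local Open Scope quotient_scope.

(** * The injective hull of a nonsingular module *)

Section EssentialHoms.
Variables (R : pzRingType) (M : lmodType R).
Implicit Types (f g : R -> M) (L : set R).

Definition linear_on L f : Prop :=
  forall r x y, L x -> L y -> f (r * x + y) = r *: f x + f y.

(** A homomorphism defined on an essential left ideal is represented by a total
    function whose values outside that left ideal are arbitrary. *)
Definition dense_hom : set (R -> M) :=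
  [set f | exists2 L, @essential R R^o L & linear_on L f].

Lemma dense_hom_zmod_closed : zmod_closed [in dense_hom].
Proof.
split.
  rewrite inE; exists [set: R]; first exact: essentialT.
  by move=> r x y _ _; rewrite scaler0 addr0.
move=> f g; rewrite !inE => -[L eL fL] [K eK gK].
exists (L `&` K); first exact: essentialI.
move=> r x y [Lx Kx] [Ly Ky].
rewrite /GRing.add /= /GRing.opp /= fL // gK //.
by rewrite scalerBr opprD addrACA.
Qed.

Definition dense_hom_pred : {pred R -> M} := [in dense_hom].
HB.instance Definition _ :=
  GRing.isZmodClosed.Build (R -> M) dense_hom_pred dense_hom_zmod_closed.

Definition dense_hom_type := {f : R -> M | f \in dense_hom_pred}.
HB.instance Definition _ := SubChoice.on dense_hom_type.
HB.instance Definition _ := [SubChoice_isSubZmodule of dense_hom_type by <:].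
Implicit Types u v : dense_hom_type.

Lemma dense_hom_ext u v : sval u =1 sval v -> u = v.
Proof. by move=> uv; apply: val_inj; apply/funext. Qed.

Lemma dense_homD u v x : sval (u + v) x = sval u x + sval v x.
Proof. by []. Qed.

Lemma dense_homB u v x : sval (u - v) x = sval u x - sval v x.
Proof. by []. Qed.

Definition dense_null : set dense_hom_type :=
  [set u | exists2 L, @essential R R^o L & forall x, L x -> sval u x = 0].

Lemma dense_null_zmod_closed : zmod_closed [in dense_null].
Proof.
split; first by rewrite inE; exists [set: R] => //; apply: essentialT.
move=> u v; rewrite !inE => -[L eL uL] [K eK vK].
exists (L `&` K); first exact: essentialI.
move=> x [/uL ux /vK vx]; by rewrite dense_homB ux vx subr0.
Qed.

Definition dense_null_pred : {pred dense_hom_type} := [in dense_null].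
HB.instance Definition _ :=
  GRing.isZmodClosed.Build dense_hom_type dense_null_pred
    dense_null_zmod_closed.

(** The direct limit of the groups [Hom(L, M)] over the essential left ideals
    [L]. *)
Definition hull := Quotient.quot (dense_null_pred : zmodClosed dense_hom_type).
HB.instance Definition _ := GRing.Zmodule.on hull.

Definition germ (u : dense_hom_type) : hull := \pi_hull u.

Lemma germ_surj (e : hull) : exists u, e = germ u.
Proof. by exists (repr e); rewrite /germ reprK. Qed.

Lemma germB u v : germ (u - v) = germ u - germ v.
Proof. exact: (raddfB \pi_hull). Qed.

Lemma germD u v : germ (u + v) = germ u + germ v.
Proof. exact: (raddfD \pi_hull). Qed.

Lemma germ_eq u v : germ u = germ v <->
  exists2 L, @essential R R^o L & forall x, L x -> sval u x = sval v x.
Proof.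
have -> : germ u = germ v <-> dense_null (u - v).
  pose N : zmodClosed dense_hom_type := dense_null_pred.
  have -> : (germ u = germ v) = is_true (u - v \in N).
    by rewrite (Quotient.idealrBE N); apply/propext; split=> /eqP.
  by split=> [/set_mem|uv]; last exact: mem_set.
split=> -[L eL Luv]; exists L => // x /Luv; rewrite dense_homB.
  by move/eqP; rewrite subr_eq0 => /eqP.
by move=> ->; rewrite subrr.
Qed.

Definition DenseHom f (hf : f \in dense_hom_pred) : dense_hom_type :=
  exist (fun f => f \in dense_hom_pred) f hf.

Lemma shift_subproof a u : (fun r => sval u (r * a)) \in dense_hom_pred.
Proof.
have [L eL uL] := set_mem (svalP u); apply/mem_set.
exists [set r | L (r *: (a : R^o))]; first exact: essential_colon.
by move=> r x y Lx Ly; rewrite mulrDl -mulrA uL.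
Qed.

(** The action is precomposition with right multiplication.  On functions it is
    additive in the scalar only where [u] is linear, so it becomes a module
    structure only on germs. *)
Definition shift a u : dense_hom_type := DenseHom (shift_subproof a u).

Definition hull_scale a (e : hull) : hull := germ (shift a (repr e)).

Lemma hull_scaleE a u : hull_scale a (germ u) = germ (shift a u).
Proof.
have /germ_eq [L eL Lu] : germ (repr (germ u)) = germ u by rewrite /germ reprK.
apply/germ_eq; exists [set r | L (r *: (a : R^o))].
  exact: essential_colon.
by move=> x Lxa; rewrite /= Lu.
Qed.

Lemma hull_scaleA a b e : hull_scale a (hull_scale b e) = hull_scale (a * b) e.
Proof.
have [u ->] := germ_surj e; rewrite !hull_scaleE; congr germ.
by apply: dense_hom_ext => x /=; rewrite mulrA.
Qed.

Lemma hull_scale1 : left_id 1 hull_scale.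
Proof.
move=> e; have [u ->] := germ_surj e; rewrite hull_scaleE; congr germ.
by apply: dense_hom_ext => x /=; rewrite mulr1.
Qed.

Lemma hull_scaleDr : right_distributive hull_scale +%R.
Proof.
move=> a e e'; have [u ->] := germ_surj e; have [v ->] := germ_surj e'.
rewrite -germD !hull_scaleE -germD; congr germ.
by apply: dense_hom_ext => x; rewrite dense_homD.
Qed.

Lemma hull_scaleDl e : {morph hull_scale^~ e : a b / a + b}.
Proof.
move=> a b; have [u ->] := germ_surj e; rewrite !hull_scaleE -germD.
apply/germ_eq; have [L eL uL] := set_mem (svalP u).
exists ([set r | L (r *: (a : R^o))] `&` [set r | L (r *: (b : R^o))]).
  by apply: essentialI; apply: essential_colon.
move=> x [Lxa Lxb]; rewrite dense_homD /= mulrDr -[x * a]mul1r uL //.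
by rewrite scale1r mul1r.
Qed.

HB.instance Definition _ := GRing.Zmodule_isLmodule.Build R hull
  hull_scaleA hull_scale1 hull_scaleDr hull_scaleDl.

Lemma germZ a u : a *: germ u = germ (shift a u).
Proof. exact: hull_scaleE. Qed.

Lemma hull_incl_subproof (m : M) : (fun r => r *: m) \in dense_hom_pred.
Proof.
apply/mem_set; exists [set: R]; first exact: essentialT.
by move=> r x y _ _; rewrite scalerDl scalerA.
Qed.

Definition hull_incl (m : M) : hull := germ (DenseHom (hull_incl_subproof m)).

Lemma hull_incl_linear : linear hull_incl.
Proof.
move=> a m n; rewrite germZ -germD; congr germ; apply: dense_hom_ext => x.
rewrite dense_homD /=.
by rewrite scalerDr !scalerA.
Qed.

HB.instance Definition _ :=
  GRing.isLinear.Build R M hull *:%R hull_incl hull_incl_linear.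

Lemma linear_onZ L f r x :
  @submodule R R^o L -> linear_on L f -> L x -> f (r * x) = r *: f x.
Proof.
move=> sL fL Lx; have L0 : L 0 := submod0 sL.
have f0 : f 0 = 0.
  have := fL 1 0 0 L0 L0; rewrite mulr0 addr0 scale1r => f00.
  by apply: (addIr (f 0)); rewrite add0r -f00.
by have := fL r x 0 Lx L0; rewrite !addr0 f0 addr0.
Qed.

(** Where [u] is defined, its value is recovered from its germ by the action.
    Hence the hull is nonsingular, [M] is essential in it, and a homomorphism
    to [M] from an essential left ideal becomes multiplication by its germ. *)
Lemma scale_germ L u x : @submodule R R^o L -> linear_on L (sval u) -> L x ->
  x *: germ u = hull_incl (sval u x).
Proof.
move=> sL uL Lx; rewrite germZ; apply/germ_eq; exists [set: R].
  exact: essentialT.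
by move=> r _ /=; apply: linear_onZ uL Lx.
Qed.

Hypothesis nsM : nonsingular M.

Lemma hull_incl_inj : injective hull_incl.
Proof.
move=> m n /germ_eq [L eL Lmn]; apply/eqP; rewrite -subr_eq0; apply/eqP.
move/nonsingularP: nsM; apply; first exact: eL.
by move=> r /Lmn /= rmn; rewrite scalerBr rmn subrr.
Qed.


Lemma hull_nonsingular : nonsingular hull.
Proof.
apply/nonsingularP => e K eK Ke; have [u uE] := germ_surj e; subst e.
have [L eL uL] := set_mem (svalP u).
have -> : 0 = germ 0 by have := germB 0 0; rewrite !subrr.
apply/germ_eq; exists (K `&` L); first exact: essentialI.
move=> x [Kx Lx] /=; apply: hull_incl_inj; rewrite linear0 -(Ke x Kx).
by rewrite (scale_germ eL.1 uL).
Qed.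

Lemma hull_incl_essential (e : hull) :
  e <> 0 -> exists r m, r *: e = hull_incl m /\ r *: e <> 0.
Proof.
move=> e0; have [u uE] := germ_surj e; subst e.
have [L eL uL] := set_mem (svalP u).
apply: contrapT => noL; apply: e0.
move/nonsingularP: hull_nonsingular; apply; first exact: eL.
move=> r Lr; apply: contrapT => ru0; apply: noL.
by exists r, (sval u r); rewrite -(scale_germ eL.1 uL).
Qed.

Lemma hull_incl_preim_essential (e : hull) :
  @essential R R^o [set r | exists m, r *: e = hull_incl m].
Proof.
have [u uE] := germ_surj e; subst e.
have [L eL uL] := set_mem (svalP u).
apply: (essentialS _ _ eL); last first.
  by move=> r Lr; exists (sval u r); rewrite (scale_germ eL.1 uL).
apply/submoduleP; split; first by exists 0; rewrite scale0r linear0.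
move=> a r s /= [m rm] [n sn]; exists (a *: m + n).
by rewrite linearP scalerDl -scalerA rm sn.
Qed.

(** For Baer's criterion, let [G] be a partial homomorphism from [R] to the
    hull.  Its restriction [G0] to the elements sent into [M] extends to a
    maximal partial homomorphism [H] to [M], whose domain is essential by
    maximality.  The germ [e] of [H] satisfies [G r = r e]: an essential left
    ideal sends [G r] into [M], where [G] and [H] agree. *)
Lemma hull_injective : injective_module hull.
Proof.
apply: baer_criterion => G sG Gfun.
pose G0 : set (R^o * M) := [set p | G (p.1, hull_incl p.2)].
have sG0 : submodule G0.
  apply/submoduleP; split; first by rewrite /G0 /= linear0; apply: (submod0 sG).
  move=> a p q Gp Gq; rewrite /G0 /= linearP.
  exact: submodD sG (submodZ a sG Gp) Gq.
pose Z : set (R^o * M) := [set p | p.1 = 0].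
have sZ : submodule Z.
  apply/submoduleP; split=> // a p q; rewrite /Z /= => -> ->.
  by rewrite scaler0 addr0.
have [|H [sH G0H HZ0 Hmax]] := complement_exists (B := Z) sG0.
  move=> [r m] + r0; rewrite /G0 /= [r]r0 => /Gfun m0.
  by congr pair; apply: hull_incl_inj; rewrite linear0.
have eHZ := essential_sum sH sZ HZ0 Hmax.
have Hfunc (r : R) m m' : H (r, m) -> H (r, m') -> m = m'.
  move=> Hv Hw; apply/eqP; rewrite -subr_eq0.
  have := submodB sH Hv Hw; rewrite [_ - _]surjective_pairing /= subrr.
  by move=> /HZ0 /(_ erefl) [->].
pose L : set R := [set r | exists m, H (r, m)].
have eL : @essential R R^o L.
  split.
    apply/submoduleP; split; first by exists 0; apply: (submod0 sH).
    move=> a r s /= [m Hm] [n Hn]; exists (a *: m + n).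
    exact: submodD sH (submodZ a sH Hm) Hn.
  move=> r r0; have [|s [[t m] Htm [[t' m'] t'0 sE]] s0] := eHZ.2 (r, 0).
    by case.
  have tE : t = s *: r.
    by have := congr1 fst sE; rewrite /= (t'0 : t' = 0) addr0.
  exists s; first by exists m; rewrite -tE.
  by move=> sr; apply: s0; rewrite [LHS]surjective_pairing /= sr scaler0.
have /choice[f fE] : forall r : R, exists m, L r -> H (r, m).
  by move=> r; have [[m Hm]|nLr] := pselect (L r); [exists m|exists 0].
have fL : linear_on L f.
  move=> a r s Lr Ls; apply: (Hfunc (a * r + s)).
    apply: fE; apply: (submodD eL.1 _ Ls); apply: (submodZ a eL.1 Lr).
  exact: submodD sH (submodZ a sH (fE _ Lr)) (fE _ Ls).
have dense_f : f \in dense_hom_pred by apply/mem_set; exists L.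
exists (germ (DenseHom dense_f)) => r e Gre.
apply/eqP; rewrite -subr_eq0; apply/eqP.
move/nonsingularP: hull_nonsingular; apply.
  exact: (hull_incl_preim_essential e).
move=> s [m sm]; rewrite scalerBr scalerA.
have Hsr : H (s * r, m).
  apply: G0H; rewrite /G0 /= -sm; exact: (submodZ s sG Gre).
have Lsr : L (s * r) by exists m.
rewrite (@scale_germ L (DenseHom dense_f) _ eL.1 fL Lsr) /= sm.
rewrite (Hfunc _ _ _ (fE _ Lsr) Hsr).
by rewrite subrr.
Qed.

End EssentialHoms.

(** * Minimal primes and uniform left ideals *)

Section Ring.
Variable R : pzRingType.
Implicit Types I J U P Q X : set R.

Lemma left_idealM I a x : left_ideal I -> I x -> I (a * x).
Proof. exact: (@submodZ R R^o). Qed.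

Lemma left_ideal_annihilator X : left_ideal (left_annihilator X).
Proof.
apply/submoduleP; split; first by move=> x _; rewrite mul0r.
by move=> a u v uX vX x Xx; rewrite mulrDl -mulrA uX // vX // mulr0 addr0.
Qed.

Lemma ideal_annihilator X : left_ideal X -> ideal (left_annihilator X).
Proof.
move=> lX; split; first exact: left_ideal_annihilator.
by move=> u a uX x Xx; rewrite -mulrA uX //; apply: left_idealM.
Qed.

Lemma ideal_meet I J : ideal I -> ideal J -> ideal (I `&` J).
Proof.
move=> [lI rI] [lJ rJ]; split; first exact: (@submodI R R^o).
by move=> x a [Ix Jx]; split; [apply: rI|apply: rJ].
Qed.

(** Residuals of [P] replace the ideals generated by [x] and [y], which avoids
    finite sums of products: [J] consists of the [b] with [x R b] in [P], and
    [I] of the [a] with [a J] in [P]. *)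
Lemma elementwise_ideals P (x y : R) : ideal P -> (forall r, P (x * r * y)) ->
  exists I J, [/\ ideal I, ideal J, I x, J y &
    forall a b, I a -> J b -> P (a * b)].
Proof.
move=> [lP rP] xPy.
pose J : set R := [set b | forall r, P (x * r * b)].
pose I : set R := [set a | forall b, J b -> P (a * b)].
have iJ : ideal J.
  split; last by move=> b a Jb r; rewrite mulrA; apply: rP.
  apply/submoduleP; split.
    by move=> r; rewrite mulr0; apply: (submod0 lP).
  move=> a u v Ju Jv r; rewrite mulrDr [a *: u]/(a * u) mulrA -(mulrA x).
  exact: (submodD lP).
exists I, J; split=> //; last first.
- by move=> a b Ia Jb; apply: Ia.
- by move=> b Jb; have := Jb 1; rewrite mulr1.
split.
  apply/submoduleP; split.
    by move=> b _; rewrite mul0r; apply: (submod0 lP).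
  move=> r u v Iu Iv b Jb; rewrite mulrDl [r *: u]/(r * u) -mulrA.
  apply: (submodD lP); last exact: Iv.
  by apply: left_idealM lP _; apply: Iu.
move=> a r Ia b Jb; rewrite -mulrA; apply: Ia.
exact: left_idealM iJ.1 Jb.
Qed.

Lemma semiprime_elt (x : R) :
  semiprime_ring R -> (forall r, x * r * x = 0) -> x = 0.
Proof.
move=> [i0 sp] xRx; have [I [J [iI iJ Ix Jx IJ]]] := elementwise_ideals i0 xRx.
by apply: (sp _ (ideal_meet iI iJ)) => // a b [Ia _] [_ Jb]; apply: IJ.
Qed.

Lemma prime_elt P (x y : R) :
  prime_ideal P -> (forall r, P (x * r * y)) -> P x \/ P y.
Proof.
move=> [iP _ pP] xPy.
have [I [J [iI iJ Ix Jy IJ]]] := elementwise_ideals iP xPy.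
by case: (pP _ _ iI iJ IJ) => sub; [left|right]; apply: sub.
Qed.

Lemma acc_maximal (F : set (set R)) : acc_left_annihilators R ->
  (exists X, F X) -> (forall X, F X -> exists Y, X = left_annihilator Y) ->
  exists X, F X /\ forall Y, F Y -> X `<=` Y -> Y = X.
Proof.
move=> acc [X0 FX0] annF; apply: contrapT => nomax.
have /choice[g gP] X : exists Y, F X -> [/\ F Y, X `<=` Y & Y <> X].
  have [FX|nFX] := pselect (F X); last by exists X.
  apply: contrapT => noY; apply: nomax; exists X; split=> // Y FY XY.
  by apply: contrapT => YX; apply: noY; exists Y.
have FA n : F (iter n g X0) by elim: n => //= n /gP[].
have [n|n|n /(_ n.+1 (leqnSn n)) /=] := acc (fun n => iter n g X0).
- exact: annF.
- by case: (gP _ (FA n)).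
- by case: (gP _ (FA n)).
Qed.

Lemma uniform_left_ideal_eltP U : uniform_left_ideal U <->
  [/\ left_ideal U, exists2 u, U u & u <> 0 &
   forall u v, U u -> U v -> u <> 0 -> v <> 0 ->
     exists r s, r * u = s * v /\ r * u <> 0].
Proof.
split=> [[lU U0 uniU]|[lU [u Uu u0] uniU]].
  split=> //; first exact/(submod_neq0 lU).
  move=> u v Uu Uv u0 v0.
  have lineU w : U w -> [set r *: (w : R^o) | r in [set: R]] `<=` U.
    by move=> Uw _ [r _ <-]; apply: left_idealM.
  have line0 (w : R) :
      w <> 0 -> [set r *: (w : R^o) | r in [set: R]] <> [set 0].
    move=> w0; apply/submod_neq0; first exact: submod_line.
    by exists w => //; exists 1; rewrite ?scale1r.
  have := uniU _ _ (submod_line (u : R^o)) (submod_line (v : R^o))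
    (lineU _ Uu) (lineU _ Uv) (line0 _ u0) (line0 _ v0).
  have sI := submodI (submod_line (u : R^o)) (submod_line (v : R^o)).
  move=> /(submod_neq0 sI)[w [[r _ ru] [s _ sv]] w0].
  by exists r, s; rewrite [r * u]ru [s * v]sv.
split=> //; first by apply/(submod_neq0 lU); exists u.
move=> I J lI lJ IU JU /(submod_neq0 lI)[x Ix x0] /(submod_neq0 lJ)[y Jy y0].
have [r [s [rs r0]]] := uniU x y (IU _ Ix) (JU _ Jy) x0 y0.
apply/(submod_neq0 (submodI lI lJ)); exists (r * x) => //.
by split; [apply: left_idealM|rewrite rs; apply: left_idealM].
Qed.

Hypothesis semiprimeR : semiprime_ring R.

Lemma left_ideal_self_annihilates U u :
  left_ideal U -> U u -> (forall v, U v -> u * v = 0) -> u = 0.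
Proof.
move=> lU Uu uU; apply: semiprime_elt => // r.
by rewrite -mulrA uU //; apply: left_idealM.
Qed.

(** Primeness: if [I] and [J] do not kill [U], uniformity gives a common nonzero
    element [x] of [I U] and [J U]; when [I J] kills [U], [x R x = 0].
    Minimality: a prime [Q] inside the annihilator of [U] does not contain [U],
    as otherwise [U U = 0]; as [Q] contains the product of that annihilator with
    [U], it contains the annihilator. *)
Lemma annihilator_uniform_minimal U :
  uniform_left_ideal U -> minimal_prime_ideal (left_annihilator U).
Proof.
move=> /uniform_left_ideal_eltP[lU [u Uu u0] uniU]; split.
  split; first exact: ideal_annihilator.
    move=> lT; apply: u0; rewrite -[u]mul1r.
    by have : left_annihilator U 1; [rewrite lT|apply].
  move=> I J [lI rI] [lJ rJ] IJ; apply: contrapT.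
  move=> /not_orP[/existsNP[i] /not_implyP[Ii]].
  move=> /existsNP[v] /not_implyP[Uv iv] /existsNP[j] /not_implyP[Jj].
  move=> /existsNP[w] /not_implyP[Uw jw].
  have [r [s [rs r0]]] :=
    uniU _ _ (left_idealM i lU Uv) (left_idealM j lU Uw) iv jw.
  apply: r0; apply: semiprime_elt => // t.
  rewrite {2}rs !mulrA; apply: (IJ _ j _ Jj w Uw).
  by do 3 apply: (rI); apply: left_idealM.
move=> Q pQ QU; rewrite eqEsubset; split=> // x xU.
have [v Uv nQv] : exists2 v, U v & ~ Q v.
  apply: contrapT => noQ; apply: u0; apply: (left_ideal_self_annihilates lU Uu).
  by apply: QU; apply: contrapT => nQu; apply: noQ; exists u.
have [|//|//] := prime_elt pQ (x := x) (y := v).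
move=> r; rewrite -mulrA xU; last exact: left_idealM.
by case: pQ => -[lQ _] _ _; apply: (submod0 lQ).
Qed.

(** Among the nonzero singular elements choose [z] with maximal left
    annihilator.  If [z r z] were nonzero, it would be singular, hence have the
    same annihilator as [z]; but [r z] is singular, so its annihilator contains
    a nonzero [s z], and then [s] kills [z r z] without killing [z].  Thus
    [z R z = 0]. *)
Lemma acc_nonsingular : acc_left_annihilators R -> nonsingular R^o.
Proof.
move=> acc; apply/nonsingularP => z0 L0 eL0 Lz0; apply: contrapT => z00.
pose ann (z : R) := left_annihilator [set z].
have annE z r : ann z r <-> r * z = 0.
  by split=> [/(_ z erefl)//|rz x ->].
pose F : set (set R) :=
  [set X | exists z, [/\ z <> 0, @essential R R^o (ann z) & X = ann z]].
have lann z : @submodule R R^o (ann z) by apply: left_ideal_annihilator.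
have [||_ [[z [z_neq0 ez ->]] zmax]] := @acc_maximal F acc.
- exists (ann z0), z0; split=> //; apply: (essentialS _ _ eL0) => // r Lr.
  by apply/annE; apply: Lz0.
- by move=> X [z [_ _ ->]]; exists [set z].
apply: z_neq0; apply: semiprime_elt => // r; apply: contrapT => zrz.
have [|s] := (essential_colon (r : R^o) ez).2 z.
  by move=> z0'; apply: zrz; rewrite z0' !mul0r.
rewrite [s *: _]/(s * z) /= => /annE szrz sz.
have : ann (z * r * z) = ann z.
  apply: zmax.
    exists (z * r * z); split=> //.
    apply: (essentialS _ _ ez) => // t /annE tz; apply/annE.
    by rewrite !mulrA tz !mul0r.
  by move=> t /annE tz; apply/annE; rewrite !mulrA tz !mul0r.
move=> annzrz; apply: sz; apply/annE; rewrite -annzrz; apply/annE.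
by rewrite !mulrA; apply: szrz.
Qed.

Hypothesis accR : acc_left_annihilators R.
Hypothesis uniformR : forall I, left_ideal I -> I <> [set 0] ->
  exists U, uniform_left_ideal U /\ U `<=` I.

(** Among the ideals [A] not contained in [P] choose one with maximal left
    annihilator, and a uniform [U] inside [A].  If the annihilator [N] of [U]
    were not in [P], then the meet of [A] and [N] would not be either, so it
    would have the same annihilator as [A].  But [U] kills [N] by semiprimeness,
    so [U] would kill [A], which contains [U].  Hence [N] is contained in [P],
    and equal to it by minimality. *)
Lemma minimal_prime_annihilator P : minimal_prime_ideal P ->
  exists2 U, uniform_left_ideal U & P = left_annihilator U.
Proof.
move=> [pP Pmin].
suff [U uU UP] : exists2 U, uniform_left_ideal U & left_annihilator U `<=` P.
  exists U => //; rewrite (Pmin (left_annihilator U)) //.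
  by case: (annihilator_uniform_minimal uU).
apply: contrapT => noU.
have nU U : uniform_left_ideal U -> exists2 x, left_annihilator U x & ~ P x.
  move=> uU; apply: contrapT => nx; apply: noU; exists U => // x Ux.
  by apply: contrapT => nPx; apply: nx; exists x.
pose F : set (set R) := [set X | exists A,
  [/\ ideal A, exists2 a, A a & ~ P a & X = left_annihilator A]].
have [||_ [[A [iA [a Aa nPa] ->]] Amax]] := @acc_maximal F accR.
- exists (left_annihilator [set: R]), [set: R]; split=> //.
    by split=> //; apply: (essentialT R^o).1.
  case: pP => _ PT _; apply: contrapT => noa; apply: PT.
  rewrite eqEsubset; split=> // x _.
  by apply: contrapT => nPx; apply: noa; exists x.
- by move=> X [A [_ _ ->]]; exists A.
have P0 : P 0 by case: pP => -[lP _] _ _; apply: (submod0 lP).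
have [|U [uU UA]] := uniformR iA.1.
  by move=> A0; apply: nPa; move: Aa; rewrite A0 => ->.
have /uniform_left_ideal_eltP[lU [u Uu u0] _] := uU.
have [x Ux nPx] := nU U uU.
have iU := ideal_annihilator lU.
have annA : left_annihilator (A `&` left_annihilator U) = left_annihilator A.
  apply: Amax; last by move=> r rA y [Ay _]; apply: rA.
  exists (A `&` left_annihilator U); split=> //; first exact: ideal_meet.
  apply: contrapT => noy.
  have [|/nPa//|/nPx//] := prime_elt pP (x := a) (y := x).
  move=> r; apply: contrapT => naxr; apply: noy.
  exists (a * r * x) => //; split.
    by rewrite -mulrA; apply: iA.2.
  exact: left_idealM iU.1 Ux.
apply: u0; apply: (left_ideal_self_annihilates lU Uu) => v Uv.
suff : left_annihilator A u by apply; apply: UA.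
rewrite -annA => y [_ yU]; apply: semiprime_elt => // r.
have yru : y * (r * u) = 0 by apply: yU; apply: left_idealM.
have -> : u * y * r * (u * y) = u * (y * (r * u)) * y by rewrite !mulrA.
by rewrite yru mulr0 mul0r.
Qed.

End Ring.

(** * The assassinator and the correspondence *)

Section Classification.
Variable R : pzRingType.
Implicit Types (V W : lmodType R) (U P : set R).

Definition assassin V : set R :=
  [set p | exists2 w : V, w <> 0 & forall t, (p * t) *: w = 0].

Lemma assassin_sub V W (h : {linear V -> W}) :
  injective h -> assassin V `<=` assassin W.
Proof.
move=> inj_h p [w w0 pw]; exists (h w).
  by move=> hw; apply: w0; apply: inj_h; rewrite hw linear0.
by move=> t; rewrite -linearZ pw linear0.
Qed.

Lemma assassin_isomorphic V W : isomorphic V W -> assassin V = assassin W.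
Proof.
move=> [h [k hK kK]]; rewrite eqEsubset; split.
  by apply: (assassin_sub (h := h)); apply: can_inj hK.
have [g gE] : exists g : {linear W -> V}, g =1 k.
  apply: linear_mapP => a u v; apply: (can_inj hK).
  by rewrite linearP !kK.
by apply: (assassin_sub (h := g)) => u v; rewrite !gE; apply: (can_inj kK).
Qed.

(** The map [u |-> u x] is injective on [U]; when [V] is injective, every
    embedding of a left ideal [U] in [V] has this form. *)
Definition embeds_by U V (x : V) := forall u, U u -> u *: x = 0 -> u = 0.

Hypothesis semiprimeR : semiprime_ring R.

(** If [p] annihilates the submodule generated by [w], then by uniformity it
    annihilates a nonzero [R s u x], hence [R s u]; as the annihilator of [U] is
    prime and does not contain the nonzero element [s u] of [U], it contains
    [p]. *)
Lemma assassin_uniform V U (x : V) : uniform V -> uniform_left_ideal U ->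
  embeds_by U x -> assassin V = left_annihilator U.
Proof.
move=> uV uU Ux.
have [pU _] := annihilator_uniform_minimal semiprimeR uU.
have /uniform_left_ideal_eltP[lU [u Uu u0] _] := uU.
rewrite eqEsubset; split=> p.
  move=> [w w0 pw]; have ux0 : u *: x <> 0 by move=> /(Ux _ Uu).
  have [r [s [rs r0]]] := uV w (u *: x) w0 ux0.
  have Usu : U (s * u) by apply: left_idealM.
  have [|//|su] := prime_elt pU (x := p) (y := s * u).
    move=> t; have -> : p * t * (s * u) = 0.
      apply: Ux; first exact: left_idealM.
      by rewrite -scalerA -(scalerA s) -rs scalerA -mulrA pw.
    by move=> y _; rewrite mul0r.
  case: r0; rewrite rs scalerA.
  by rewrite (left_ideal_self_annihilates semiprimeR lU Usu) ?scale0r.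
move=> pU'; exists (u *: x); first by move=> /(Ux _ Uu).
by move=> t; rewrite scalerA -mulrA pU' ?scale0r //; apply: left_idealM.
Qed.

Hypothesis accR : acc_left_annihilators R.
Hypothesis uniformR : forall I : set R, left_ideal I -> I <> [set 0] ->
  exists U : set R, uniform_left_ideal U /\ U `<=` I.

Lemma nonsingular_embeds V : nonsingular V -> (exists x : V, x <> 0) ->
  exists U (x : V), uniform_left_ideal U /\ embeds_by U x.
Proof.
move=> /nonsingularP nsV [x x0].
have [v v0 vx] : exists2 v : R, v <> 0 & forall r, r * v *: x = 0 -> r * v = 0.
  apply: contrapT => nov; apply: x0; apply: (nsV x [set r | r *: x = 0]) => //.
  split.
    apply: (@submod_colon R V [set 0]).
    apply/submoduleP; split=> // a u v -> ->.
    by rewrite scaler0 addr0.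
  move=> v v0; apply: contrapT => nor; apply: nov; exists v => // r rvx.
  by apply: contrapT => rv; apply: nor; exists r.
pose I := [set r *: (v : R^o) | r in [set: R]].
have lI : left_ideal I := submod_line (v : R^o).
have [|U [uU UI]] := uniformR lI.
  by apply/(submod_neq0 lI); exists v => //; exists 1; rewrite ?scale1r.
exists U, x; split=> // u /UI[r _ <-]; exact: vx.
Qed.

(** Some [u'] has [U u'] nonzero, as otherwise [U] would annihilate [U'] and
    hence itself.  If right multiplication by [u'] had a nonzero kernel in the
    uniform [U], an essential left ideal would send any [u] into that kernel and
    kill [u u'], contrary to nonsingularity. *)
Lemma uniform_left_ideals_map U U' :
  uniform_left_ideal U -> uniform_left_ideal U' ->
  left_annihilator U = left_annihilator U' ->
  exists2 u', U' u' & forall v, U v -> v * u' = 0 -> v = 0.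
Proof.
move=> /uniform_left_ideal_eltP[lU [u0 Uu0 u0n] uniU].
move=> /uniform_left_ideal_eltP[lU' _ _] UU'.
have [u Uu [u' Uu' uu']] : exists2 u, U u & exists2 u', U' u' & u * u' <> 0.
  apply: contrapT => nou; apply: u0n.
  suff : left_annihilator U u0 by apply: left_ideal_self_annihilates.
  rewrite UU' => y Uy; apply: contrapT => u0y; apply: nou.
  by exists u0 => //; exists y.
exists u' => // v Uv vu'; apply: contrapT => v0; apply: uu'.
have /nonsingularP := acc_nonsingular semiprimeR accR.
move=> /(_ (u * u' : R) [set r | U (r * u) /\ r * u * u' = 0]).
apply; last first.
  by move=> r [_ ruu']; apply: etrans ruu'; apply: mulrA.
split.
  apply/submoduleP; split.
    by rewrite /= !mul0r; split=> //; apply: (submod0 lU).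
  move=> a r s [Ur ru] [Us su] /=; rewrite [a *: r]/(a * r) mulrDl -(mulrA a).
  split; first by apply: (submodD lU) => //; apply: left_idealM.
  by rewrite mulrDl -mulrA ru su mulr0 addr0.
move=> q q0; have [qu|qu] := pselect (q * u = 0).
  exists 1; last by rewrite scale1r.
  by rewrite /= scale1r qu mul0r; split=> //; apply: (submod0 lU).
have [r [s [rs r0]]] := uniU _ _ (left_idealM q lU Uu) Uv qu v0.
exists r.
  rewrite /= [r *: _]/(r * q) -(mulrA r) rs; split; first exact: left_idealM.
  by rewrite -mulrA vu' mulr0.
by move=> rq; apply: r0; rewrite mulrA (rq : r * q = 0) mul0r.
Qed.

(** The common submodule [U] gives a partial homomorphism [v x |-> v u' x'] from
    [V] to [W].  Its extension [h] is injective because [V] is uniform, and it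
    has a retraction because [V] is injective, so that it is bijective because
    [W] is indecomposable. *)
Lemma assassin_complete V W :
  indecomposable_nonsingular_injective V ->
  indecomposable_nonsingular_injective W ->
  assassin V = assassin W -> isomorphic V W.
Proof.
move=> [indV nsV injV] [indW nsW injW] VW.
have uV := indecomposable_uniform nsV injV indV.
have uW := indecomposable_uniform nsW injW indW.
have [U [x [uU Ux]]] := nonsingular_embeds nsV indV.1.
have [U' [x' [uU' Ux']]] := nonsingular_embeds nsW indW.1.
have [|u' Uu' inj_u'] := uniform_left_ideals_map uU uU'.
  by rewrite -(assassin_uniform uV uU Ux) VW (assassin_uniform uW uU' Ux').
have /uniform_left_ideal_eltP[lU [u Uu u0] _] := uU.
have /uniform_left_ideal_eltP[lU' _ _] := uU'.
pose G : set (V * W) :=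
  [set p | exists2 v, U v & p = (v *: x, (v * u') *: x')].
have sG : submodule G.
  apply/submoduleP; split.
    by exists 0; rewrite ?mul0r ?scale0r //; apply: (submod0 lU).
  move=> a _ _ [v Uv ->] [w Uw ->]; exists (a * v + w).
    by apply: (submodD lU) => //; apply: left_idealM.
  by rewrite mulrDl -mulrA !scalerDl -!scalerA.
have [|h hE] := injective_extend injW sG.
  by move=> _ [v Uv [/esym/(Ux _ Uv) -> ->]]; rewrite mul0r scale0r.
have inj_h : injective h.
  move=> y z yz; apply/eqP; rewrite -subr_eq0; apply/eqP.
  apply: contrapT => yz0.
  have ux0 : u *: x <> 0 by move=> /(Ux _ Uu).
  have [r [s [rs r0]]] := uV _ _ yz0 ux0; apply: r0.
  have Usu : U (s * u) by apply: left_idealM.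
  rewrite rs scalerA; suff -> : s * u = 0 by rewrite scale0r.
  apply: (inj_u' _ Usu); apply: Ux'; first exact: left_idealM.
  rewrite -(hE ((s * u) *: x) ((s * u * u') *: x')); last by exists (s * u).
  by rewrite -scalerA -rs linearZ linearB /= yz subrr scaler0.
have [k kK] := injV _ _ h idfun inj_h.
by exists h; apply: split_mono_bijective indW kK indV.1.
Qed.

Lemma minimal_prime_assassin P : minimal_prime_ideal P ->
  exists V, indecomposable_nonsingular_injective V /\ assassin V = P.
Proof.
move=> /(minimal_prime_annihilator semiprimeR accR uniformR)[U uU ->].
have /uniform_left_ideal_eltP[lU [u Uu u0] uniU] := uU.
pose M : lmodType R := submod_type lU.
have valZ a (m : M) : val (a *: m) = a * val m by [].
have nsM : nonsingular M.
  apply/nonsingularP => m L eL Lm; apply: val_inj.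
  have /nonsingularP := acc_nonsingular semiprimeR accR; apply; first exact: eL.
  by move=> r /Lm /(congr1 val).
have uE : uniform (hull M).
  move=> e f e0 f0.
  have [r [m [rm r0]]] := hull_incl_essential nsM e0.
  have [s [n [sn s0]]] := hull_incl_essential nsM f0.
  have [|||| a [b [ab a0]]] := uniU (val m) (val n).
  - exact: submod_typeP.
  - exact: submod_typeP.
  - move=> m0; apply: r0; rewrite rm (_ : m = 0) ?linear0 //; exact: val_inj.
  - move=> n0; apply: s0; rewrite sn (_ : n = 0) ?linear0 //; exact: val_inj.
  exists (a * r), (b * s); rewrite -!scalerA rm sn -!linearZ; split.
    by congr (hull_incl _); apply: val_inj.
  move=> am; apply: a0; rewrite -valZ.
  rewrite (_ : a *: m = 0) //; apply: (hull_incl_inj nsM).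
  by rewrite am linear0.
have [m mE] := submod_type_sub lU Uu.
have E0 : exists e : hull M, e <> 0.
  exists (hull_incl (m : M)) => m0; apply: u0; rewrite -mE.
  by rewrite (_ : m = 0) //; apply: (hull_incl_inj nsM); rewrite m0 linear0.
exists (hull M); split.
  split; first exact: uniform_indecomposable.
    exact: hull_nonsingular.
  exact: hull_injective.
(* By injectivity, [U -> hull M] is right multiplication by an element. *)
pose G : set (R^o * hull M) := [set p | exists n : M, p = (val n, hull_incl n)].
have sG : submodule G.
  apply/submoduleP; split.
    by exists 0; rewrite (linear0 (@hull_incl R M)).
  move=> a _ _ [n ->] [n' ->]; exists (a *: n + n').
  by rewrite (linearP (@hull_incl R M)).
have [|h hE] := injective_extend (hull_injective nsM) sG.
  move=> _ [n [/esym n0 ->]].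
  by rewrite (_ : n = 0) ?linear0 //; apply: val_inj.
apply: (assassin_uniform (x := h 1)) => // v Uv.
have [n nE] := submod_type_sub lU Uv.
rewrite -linearZ /= (_ : v *: (1 : R^o) = v); last exact: mulr1.
rewrite (hE v (hull_incl (n : M))); last by exists n; rewrite nE.
move=> n0; rewrite -nE (_ : n = 0) //.
by apply: (hull_incl_inj nsM); rewrite n0 linear0.
Qed.

Lemma assassin_minimal_prime V :
  indecomposable_nonsingular_injective V -> minimal_prime_ideal (assassin V).
Proof.
move=> [indV nsV injV]; have uV := indecomposable_uniform nsV injV indV.
have [U [x [uU Ux]]] := nonsingular_embeds nsV indV.1.
by rewrite (assassin_uniform uV uU Ux); apply: annihilator_uniform_minimal.
Qed.

End Classification.

(* The first conjunct says that a set of representatives exists, so that the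
   second one, about every such set, is not vacuous. *)
Theorem corollary2p13 (R : pzRingType)
    (semiprimeR : semiprime_ring R)
    (accR : acc_left_annihilators R)
    (uniformR : forall I : set R, left_ideal I -> I <> [set 0] ->
       exists U : set R, uniform_left_ideal U /\ U `<=` I) :
  (exists (T : Type) (E : T -> lmodType R),
     representatives (@indecomposable_nonsingular_injective R) E) /\
  (forall (T : Type) (E : T -> lmodType R),
     representatives (@indecomposable_nonsingular_injective R) E ->
     exists f : T -> {P : set R | minimal_prime_ideal P}, bijective f).
Proof.
have complete := assassin_complete semiprimeR accR uniformR.
have onto := minimal_prime_assassin semiprimeR accR uniformR.
have minimal := assassin_minimal_prime semiprimeR uniformR.
split=> [|T E [CE repE injE]].
  have [E EP] : {E : {P : set R | minimal_prime_ideal P} -> lmodType R |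
      forall P, indecomposable_nonsingular_injective (E P) /\
        assassin (E P) = sval P}.
    exists (fun P => projT1 (cid (onto _ (svalP P)))) => P.
    exact: projT2 (cid (onto _ (svalP P))).
  exists {P : set R | minimal_prime_ideal P}, E; split=> [P|V CV|P Q].
  - exact: (EP P).1.
  - exists (exist _ _ (minimal V CV)).
    by apply: complete => //; [exact: (EP _).1|rewrite (EP _).2].
  - by move=> /assassin_isomorphic; rewrite !(EP _).2 => /eq_sig_hprop; apply.
pose f t : {P : set R | minimal_prime_ideal P} := exist _ _ (minimal _ (CE t)).
have /choice[g gE] (P : {P : set R | minimal_prime_ideal P}) :
    exists t, assassin (E t) = sval P.
  have [V [CV <-]] := onto _ (svalP P); have [t Vt] := repE V CV.
  by exists t; rewrite (assassin_isomorphic Vt).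
exists f, g => [t|P].
  by apply: injE; apply: complete => //; rewrite gE.
apply: eq_sig_hprop => [Q p q|]; first exact: Prop_irrelevance.
by rewrite /= gE.
Qed.
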